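(* Let $a,b$ be integers with $0<b<a$, let $S=\langle a,a+1,\ldots,a+b\rangle$ with conductor $c$, and let $m\ge 2c-1$. Then every ordered $(S,m,r)$-amenable set is an optimal configuration of cardinality $r$.
   Context: For $x\in S$, $\mathrm D(x)=\{\alpha\in S\mid x-\alpha\in S\}$, and for a set $M\subseteq S$, $\mathrm D(M)=\bigcup_{x\in M}\mathrm D(x)$. For $m\in S$, $\delta^r(m)=\min\{\sharp\mathrm D(\{m_1,\ldots,m_r\})\mid m\le m_1<\cdots<m_r,\ m_i\in S\}$. A finite subset of $S\cap[m,\infty)$ is a configuration; a configuration $M$ of cardinality $r$ is optimal if $\sharp\mathrm D(M)=\delta^r(m)$. A set $M=\{m_1<\cdots<m_r\}\subseteq S$ with $2c-1\le m=m_1$ is $(S,m,r)$-amenable if $\mathrm D(m_i)\cap[m,\infty)\subseteq M$ for all $i$. The ground is $\{m,m+1,\ldots,m+a+b-1\}$, and the shadow of $M$ is $M\cap\{m,\ldots,m+a+b-1\}$. For a finite $M\subseteq S\cap[m,\infty)$, let $J$ be the set of $j\in\{0,\ldots,a-1\}$ such that $x-(m+b)=qa+j$ for some $x\in M$ and some integer $q\ge 0$; if $J\neq\emptyset$ let $j_0=\max J$ and let the wagon of $M$ be $W=\{x\in M\mid x-(m+b)=qa+j_0\text{ for some integer }q\}$. An element $P\in M$ is the pivot of $M$ if either $P<m+b$ and $P=\max M$, or $P=\max W$. An $(S,m,r)$-amenable set $M$ with pivot $P$ is ordered amenable if (i) its shadow is $\{m,m+1,\ldots,m+t\}$ for some integer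 $0\le t<a+b-1$, and (ii) whenever $s\in S\setminus M$ is such that $M\cup\{s\}$ is $(S,m,r+1)$-amenable with the same shadow as $M$, we have $s=P+a$. *)

(* Defs.v *)
From HB Require Import structures.
From mathcomp Require Import all_boot all_order all_algebra.
From mathcomp Require Import finmap.
Set Implicit Arguments. Unset Strict Implicit. Unset Printing Implicit Defensive.


Inductive gen_semigroup (a b : nat) : nat -> Prop :=
| gs0 : gen_semigroup a b 0
| gsS n g : gen_semigroup a b n -> a <= g <= a + b -> gen_semigroup a b (n + g).

Definition is_conductor (S : nat -> Prop) (c : nat) : Prop :=
  (forall n, c <= n -> S n) /\
  (forall c', (forall n, c' <= n -> S n) -> c <= c').

Definition card_is (P : nat -> Prop) (k : nat) : Prop :=
  exists s : seq nat, [/\ uniq s, (forall x, x \in s <-> P x) & size s = k].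

(* D(x) = { alpha in S | x - alpha in S } (integer subtraction, so alpha <= x). *)
Definition Dx (S : nat -> Prop) (x alpha : nat) : Prop :=
  [/\ S alpha, alpha <= x & S (x - alpha)].

Definition DM (S : nat -> Prop) (M : {fset nat}) (alpha : nat) : Prop :=
  exists2 x, x \in M & Dx S x alpha.

Definition configuration (S : nat -> Prop) (m : nat) (M : {fset nat}) : Prop :=
  forall x, x \in M -> S x /\ m <= x.

Definition is_delta (S : nat -> Prop) (r m d : nat) : Prop :=
  (exists M : {fset nat},
      [/\ configuration S m M, #|` M|%fset = r & card_is (DM S M) d]) /\
  (forall (M : {fset nat}) d', configuration S m M -> #|` M|%fset = r ->
      card_is (DM S M) d' -> d <= d').

Definition optimal_config (S : nat -> Prop) (r m : nat) (M : {fset nat}) : Prop :=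
  [/\ configuration S m M, #|` M|%fset = r &
      exists d, is_delta S r m d /\ card_is (DM S M) d].

Definition amenable (S : nat -> Prop) (c m r : nat) (M : {fset nat}) : Prop :=
  [/\ (forall x, x \in M -> S x), #|` M|%fset = r, 2 * c - 1 <= m,
      m \in M /\ (forall x, x \in M -> m <= x) &
      (forall x alpha, x \in M -> Dx S x alpha -> m <= alpha -> alpha \in M)].

Definition in_shadow (a b m : nat) (M : {fset nat}) (x : nat) : Prop :=
  x \in M /\ m <= x <= m + a + b - 1.

Definition inJ (a b m : nat) (M : {fset nat}) (j : nat) : Prop :=
  j < a /\ exists x q, x \in M /\ x = m + b + q * a + j.

Definition in_wagon (a b m : nat) (M : {fset nat}) (x : nat) : Prop :=
  x \in M /\
  exists j0, (inJ a b m M j0 /\ forall j, inJ a b m M j -> j <= j0) /\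
    exists q : int, (x%:Z - (m + b)%:Z = q * a%:Z + j0%:Z)%R.

Definition is_pivot (a b m : nat) (M : {fset nat}) (P : nat) : Prop :=
  P \in M /\
  ((P < m + b /\ forall x, x \in M -> x <= P) \/
   (in_wagon a b m M P /\ forall x, in_wagon a b m M x -> x <= P)).

Definition ordered_amenable (S : nat -> Prop) (a b c m r : nat) (M : {fset nat})
  : Prop :=
  amenable S c m r M /\
  exists P, [/\ is_pivot a b m M P,
    (exists t, t < a + b - 1 /\
       forall x, in_shadow a b m M x <-> m <= x <= m + t) &
    (forall s, S s -> s \notin M -> amenable S c m r.+1 (s |` M)%fset ->
       (forall x, in_shadow a b m (s |` M)%fset x <-> in_shadow a b m M x) ->
       s = P + a)].

(* Main.v *)
Require Import Defs.
From mathcomp Require Import all_boot all_order all_algebra.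
From mathcomp Require Import finmap zify.

(** Put n = a + b.  For a configuration X with N = D(X) \cap [m, oo), ground part
T = N \cap [m, m + n) and s = #T, one has #D(X) = #N + #(S \cap [0, m)) - bad,
where bad counts the elements of S \cap [0, m) outside D(X).  Cut both sides of
m into windows of length n and read them in Z/n.  Adding an interval of length q
to a nonempty subset of Z/n gains q elements unless it fills Z/n; hence the k-th
window of N has at most s - k b elements (if s < n), and the k-th window of bad
elements at most a - k b - s.  An ordered amenable set M with shadow
{m, ..., m + t} attains the second bound for s = t + 1, and contains m + t and
all m + k n + j with j + k b < t, since a missing one would give an addable
element different from P + a.  So a configuration X with #X = #M and s <= t is
impossible, and if s > t then D(X) misses no more elements below m than D(M). *)

(** * Counting by windows of length n *)

Lemma count_iota_card (P : pred nat) p n :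
  count P (iota p n) = #|[set i : 'I_n | P (p + i)]|.
Proof.
rewrite -[p in iota p]addn0 iotaDl count_map -val_enum_ord count_map.
by rewrite cardsE cardE -size_filter enumT /enum_mem.
Qed.

Lemma count_windows (P : pred nat) n K :
  count P (iota 0 (K * n)) = \sum_(k < K) #|[set i : 'I_n | P (k * n + i)]|.
Proof.
elim: K => [|K IH]; first by rewrite big_ord0.
by rewrite mulSn addnC iotaD count_cat IH big_ord_recr /= count_iota_card.
Qed.

(** When a distance below m is written (k+1)n - z, the element at that distance is congruent to m +
    z mod n, so windows below m carry the same residues as the ground. *)
Lemma count_rev_windows (P : pred nat) n K :
  count P (iota 1 (K * n)) =
  \sum_(k < K) #|[set z : 'I_n | P (k.+1 * n - z)]|.
Proof.
rewrite -[1]addn0 iotaDl count_map count_windows; apply: eq_bigr => k _.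
rewrite -(card_imset _ (@rev_ord_inj n)); congr #|pred_of_set _|.
apply/setP=> z; rewrite inE; apply/imsetP/idP => [[i]|Pz].
  rewrite inE /= => Pi ->; rewrite /=.
  by move: Pi; congr P; have := ltn_ord i; lia.
exists (rev_ord z); last by rewrite rev_ordK.
by rewrite inE /=; move: Pz; congr P; have := ltn_ord z; lia.
Qed.

(** The guard [x <= m] discards surplus distances, so L can be taken a multiple of n. *)
Lemma count_reflect (P : pred nat) m L : m <= L ->
  count P (iota 0 m) =
  count (fun x => (x <= m) && P (m - x)) (iota 1 L).
Proof.
move=> mL; rewrite -(subnKC mL) iotaD count_cat.
rewrite [X in _ = _ + X](@eq_in_count _ _ pred0); last first.
  by move=> x; rewrite mem_iota /=; lia.
rewrite count_pred0 addn0 -[1]addn0 iotaDl count_map.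
rewrite !count_iota_card -(card_imset _ (@rev_ord_inj m)).
congr #|pred_of_set _|; apply/setP=> z; rewrite !inE /=.
have zm := ltn_ord z; rewrite ?add0n ?add1n zm /=.
apply/imsetP/idP => [[i]|Pz].
  rewrite inE /= => Pi ->; move: Pi.
  by congr P; have := ltn_ord i; rewrite /=; lia.
by exists (rev_ord z); [rewrite inE|rewrite rev_ordK].
Qed.

Lemma card_ord_ltn n p : p <= n -> #|[set i : 'I_n | i < p]| = p.
Proof.
move=> pn; rewrite -(@count_iota_card (fun i => i < p) 0) -size_filter.
rewrite -[RHS](size_iota 0); apply/perm_size/uniq_perm.
- exact/filter_uniq/iota_uniq.
- exact: iota_uniq.
- by move=> x; rewrite mem_filter !mem_iota; lia.
Qed.

Lemma card_ord_gtn n p : #|[set i : 'I_n | p < i]| = n - p.+1.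
Proof.
rewrite -(@count_iota_card (fun i => p < i) 0) -size_filter.
rewrite -[RHS](size_iota p.+1); apply/perm_size/uniq_perm.
- exact/filter_uniq/iota_uniq.
- exact: iota_uniq.
- by move=> x; rewrite mem_filter !mem_iota; lia.
Qed.

(** * Adding intervals in Z/n *)

Lemma iter_ordS n i (x : 'I_n) : iter i (@ordS n) x = (x + i) %% n :> nat.
Proof.
elim: i => [|i IH] /=; first by rewrite addn0 modn_small.
by rewrite IH -addn1 modnDml addn1 addnS.
Qed.

(* Cauchy-Davenport in Z/n with an interval as one summand, where n need not be
   prime: each further shift enlarges a nonempty proper subset. *)
Lemma card_shifts n q (A E : {set 'I_n}) :
  A != set0 -> #|E| < n ->
  (forall x i, x \in A -> i <= q -> iter i (@ordS n) x \in E) ->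
  #|A| + q <= #|E|.
Proof.
elim: q A => [|q IH] A A0 En AE.
  by rewrite addn0; apply/subset_leq_card/subsetP => x /AE /(_ (leqnn 0)).
have [SA|nSA] := boolP ((@ordS n) @: A \subset A).
  have /set0Pn[x xA] := A0.
  have itA i : iter i (@ordS n) x \in A.
    by elim: i => //= i IHi; apply/(subsetP SA)/imset_f.
  have AT : A = setT.
    apply/setP=> y; rewrite inE.
    have -> : y = iter (y + n - x) (@ordS n) x.
      apply: ord_inj; rewrite iter_ordS.
      have -> : x + (y + n - x) = y + n by have := ltn_ord x; lia.
      by rewrite modnDr modn_small.
    exact: itA.
  have : #|A| <= #|E|.
    by apply/subset_leq_card/subsetP => y yA; have := AE y 0 yA isT.
  by rewrite AT cardsT card_ord; lia.
have lt : #|A| < #|A :|: (@ordS n) @: A|.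
  apply/proper_card/properP; split; first exact: subsetUl.
  by have /subsetPn[y y1 y2] := nSA; exists y => //; rewrite inE y1 orbT.
suff: #|A :|: (@ordS n) @: A| + q <= #|E| by lia.
apply: IH => // [|x i].
  by have /set0Pn[x xA] := A0; apply/set0Pn; exists x; rewrite inE xA.
rewrite inE => /orP[xA iq|/imsetP[y yA ->] iq]; first by apply: AE => //; lia.
by rewrite -iterSr; apply: AE.
Qed.

(** * The semigroup generated by an interval, and its windows *)

Lemma gen_semigroup_interval a b n :
  gen_semigroup a b n <-> exists k, k * a <= n <= k * (a + b).
Proof.
split; first by elim=> [|{}n g _ [k kn] ag]; [exists 0 | exists k.+1; lia].
case=> k; elim: k n => [|k IH] n kn.
  by have -> : n = 0 by [lia]; constructor.
(* Split off n - ka if it is a generator, leaving ka; otherwise split off the largest generator. *)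
have [le|lt] := leqP (n - k * a) (a + b).
  have -> : n = k * a + (n - k * a) by lia.
  by constructor; [apply: IH|]; lia.
have -> : n = n - (a + b) + (a + b) by lia.
by constructor; [apply: IH|]; lia.
Qed.

Lemma gen_semigroupD a b x y :
  gen_semigroup a b x -> gen_semigroup a b y -> gen_semigroup a b (x + y).
Proof.
rewrite !gen_semigroup_interval => -[k kx] [l ly].
by exists (k + l); lia.
Qed.

(** A decidable form for counting; the bound k <= n costs nothing when 0 < a, as k <= ka <= n. *)
Definition in_gen a b n := [exists k : 'I_n.+1, k * a <= n <= k * (a + b)].

Lemma in_genP a b n : 0 < a -> reflect (gen_semigroup a b n) (in_gen a b n).
Proof.
move=> a0; apply: (iffP existsP) => [[k kn]|].
  by rewrite gen_semigroup_interval; exists k.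
rewrite gen_semigroup_interval => -[k kn].
have kn1 : k < n.+1 by nia.
by exists (Ordinal kn1).
Qed.

(** For i in T and e <= (k+1)b, let z be i + e mod n, with l wraparounds. The distance i + (k+1)n -
    z equals (k+1+l)n - e, a sum of k+1+l generators. So the complement contains T + [0, (k+1)b],
    and [card_shifts] applies. *)
Lemma card_bad_window a b k (T : {set 'I_(a + b)}) : 0 < a -> T != set0 ->
  #|[set z : 'I_(a + b) |
      [forall i in T, ~~ in_gen a b (i + (k.+1 * (a + b) - z))]]|
    <= a - (k * b + #|T|).
Proof.
move=> a0 T0; set B := [set z | _].
have [->|B0] := eqVneq B set0; first by rewrite cards0.
have cB : #|~: B| + #|B| = a + b by rewrite addnC cardsC card_ord.
have : 0 < #|B| by rewrite card_gt0.
suff : #|~: B| < a + b -> #|T| + k.+1 * b <= #|~: B| by lia.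
move=> Blt; apply: card_shifts => // i e iT eq.
rewrite !inE; apply/forall_inPn; exists i => //; rewrite negbK.
apply/in_genP => //; rewrite gen_semigroup_interval iter_ordS.
exists (k.+1 + (i + e) %/ (a + b)).
have n0 : 0 < a + b by lia.
have := divn_eq (i + e) (a + b); have := ltn_pmod (i + e) n0.
set l := _ %/ _; set z := _ %% _ => zlt ie.
have -> : i + (k.+1 * (a + b) - z) = (k.+1 + l) * (a + b) - e by lia.
have : (k.+1 + l) * (a + b) = (k.+1 + l) * a + k.+1 * b + l * b by lia.
lia.
Qed.

(** Subtracting the generator n - i, with i <= b, sends residue x of window k+1 to x + i in window
    k, so each window plus [0, b] lies in the one before it. *)
Lemma count_closed_windows a b (P : pred nat) K :
  (forall x g, P x -> a + b <= x -> a <= g <= a + b -> P (x - g)) ->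
  #|[set i : 'I_(a + b) | P i]| < a + b ->
  count P (iota 0 (K * (a + b))) <=
    \sum_(k < K) (#|[set i : 'I_(a + b) | P i]| - k * b).
Proof.
move=> Pcl s_lt; rewrite count_windows; apply: leq_sum => -[k _] _ /=.
elim: k => [|k IH].
  by rewrite mul0n subn0.
set A := [set i : 'I_(a + b) | P (k.+1 * (a + b) + i)].
move: IH; set E := [set i : 'I_(a + b) | _] => IH.
have [->|A0] := eqVneq A set0; first by rewrite cards0.
suff Ab: #|A| + b <= #|E|.
  by move: IH Ab; move: #|A| #|E| #|[set i : 'I_(a + b) | P i]|; lia.
apply: card_shifts => // [|x i].
  exact: leq_ltn_trans (leq_trans IH (leq_subr _ _)) s_lt.
rewrite !inE iter_ordS => Px ib.
have xn := ltn_ord x.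
have Py : P (k * (a + b) + (x + i)).
  have -> : k * (a + b) + (x + i) = k.+1 * (a + b) + x - (a + b - i) by lia.
  by apply: Pcl => //; lia.
have [lt|ge] := ltnP (x + i) (a + b); first by rewrite modn_small.
have -> : (x + i) %% (a + b) = x + i - (a + b).
  by rewrite -{1}(subnK ge) modnDr modn_small; lia.
(* After a wraparound, a further subtraction of n is needed to reach window k. *)
rewrite addnBA //; apply: Pcl => //; lia.
Qed.

(** * Cardinalities as counts over initial segments *)

Lemma card_is_count (P : nat -> Prop) (p : pred nat) L d :
  (forall x, reflect (P x) (p x)) -> (forall x, P x -> x < L) ->
  card_is P d <-> d = count p (iota 0 L).
Proof.
move=> Pp PL.
have memP x : x \in filter p (iota 0 L) <-> P x.
  rewrite mem_filter mem_iota; split=> [/andP[/Pp]//|Px].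
  by apply/andP; split; [apply/Pp|apply: PL].
rewrite -size_filter; split=> [[s [us sP <-]]|->].
  apply/perm_size/uniq_perm => // [|x]; first exact/filter_uniq/iota_uniq.
  by apply/idP/idP => [/sP/memP|/memP/sP].
by exists (filter p (iota 0 L)); split=> //; exact/filter_uniq/iota_uniq.
Qed.

Lemma card_fset_count (X : {fset nat}) m L :
  (forall x, x \in X -> m <= x < m + L) ->
  #|` X|%fset = count (fun i => m + i \in X) (iota 0 L).
Proof.
move=> XL; rewrite -[RHS](@count_map _ _ (addn m) (mem X)) -iotaDl addn0.
rewrite -size_filter; apply/perm_size/uniq_perm => // [|x].
  exact/filter_uniq/iota_uniq.
rewrite mem_filter mem_iota.
by apply/idP/andP => [xX|[]//]; split=> //; apply: XL.
Qed.

Definition in_D a b (X : {fset nat}) y :=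
  has (fun x => [&& in_gen a b y, y <= x & in_gen a b (x - y)]) X.

Lemma in_DP a b X y : 0 < a ->
  reflect (DM (gen_semigroup a b) X y) (in_D a b X y).
Proof.
move=> a0; apply: (iffP hasP) => [[x xX /and3P[y1 y2 y3]]|[x xX [y1 y2 y3]]].
  by exists x => //; split=> //; apply/in_genP.
by exists x => //; apply/and3P; split=> //; apply/in_genP.
Qed.

(** The semigroup count below m does not depend on X, so comparing two configurations only involves
    the other terms. *)
Lemma count_D_split a b X m L :
  count (in_D a b X) (iota 0 (m + L)) +
    count (fun y => in_gen a b y && ~~ in_D a b X y) (iota 0 m) =
  count (in_gen a b) (iota 0 m) + count (fun i => in_D a b X (m + i)) (iota 0 L).
Proof.
rewrite iotaD count_cat add0n -[m in iota m L]addn0 iotaDl count_map addnAC.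
congr (_ + _); rewrite -count_predUI [X in _ + X](@eq_count _ _ pred0); last first.
  by move=> y /=; rewrite andbCA andbN andbF.
rewrite count_pred0 addn0; apply: eq_count => y /=.
case D: (in_D a b X y) => /=; last by rewrite andbT.
by case/hasP: D => x _ /and3P[->].
Qed.

(** * Bounds for arbitrary configurations *)

Section Configurations.

Context {a b c m : nat} {X : {fset nat}}.
Hypothesis a_gt0 : 0 < a.
Hypothesis c_gen : forall x, c <= x -> gen_semigroup a b x.
Hypothesis le_cm : c <= m.
Hypothesis X_ge : forall x, x \in X -> m <= x.

Let n_gt0 : 0 < a + b. Proof. by rewrite addn_gt0 a_gt0. Qed.

Lemma in_D_down x g : in_D a b X (m + x) -> a + b <= x -> a <= g <= a + b ->
  in_D a b X (m + (x - g)).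
Proof.
move=> /(in_DP _ _ _ _ a_gt0)[y yX [_ le_y Sy]] nx ag.
apply/in_DP => //; exists y => //; split; [apply: c_gen; lia|lia|].
have -> : y - (m + (x - g)) = y - (m + x) + g by lia.
by constructor.
Qed.

(** Removing copies of the generator n from any x in X reaches the ground inside D(X). *)
Lemma in_D_shadow : X != fset0 ->
  [set i : 'I_(a + b) | in_D a b X (m + i)] != set0.
Proof.
move=> /fset0Pn[x xX]; have mx := X_ge _ xX.
apply/set0Pn; exists (Ordinal (ltn_pmod (x - m) n_gt0)); rewrite inE /=.
apply/in_DP => //; exists x => //.
have := divn_eq (x - m) (a + b).
set q := _ %/ _; set z := _ %% _ => xmE.
split; [apply: c_gen; lia|lia|].
by rewrite gen_semigroup_interval; exists q; lia.
Qed.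

(** A bad y cannot differ from a ground element of D(X) by a semigroup element, since y would then
    be in D(X) too; [card_bad_window] bounds such y. *)
Lemma count_bad_le K : X != fset0 -> m <= K * (a + b) ->
  count (fun y => in_gen a b y && ~~ in_D a b X y) (iota 0 m) <=
  \sum_(k < K)
    (a - (k * b + #|[set i : 'I_(a + b) | in_D a b X (m + i)]|)).
Proof.
move=> X0 mK; rewrite (count_reflect _ _ _ mK) count_rev_windows.
apply: leq_sum => k _.
apply: leq_trans (card_bad_window _ _ _ _ a_gt0 _); last first.
  exact: in_D_shadow.
apply/subset_leq_card/subsetP => z; rewrite !inE => /and3P[le_m Sz nD].
apply/forall_inP => i; rewrite inE => /(in_DP _ _ _ _ a_gt0)[y yX [_ le_y Sy]].
apply: contra nD => /(in_genP _ _ _ a_gt0) Si.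
apply/in_DP => //; exists y => //; split; [exact/in_genP|lia|].
have -> : y - (m - (k.+1 * (a + b) - z)) =
  y - (m + i) + (i + (k.+1 * (a + b) - z)) by lia.
exact: gen_semigroupD.
Qed.

Lemma card_configuration_le K : (forall x, x \in X -> x < m + K * (a + b)) ->
  #|` X|%fset <= count (fun i => in_D a b X (m + i)) (iota 0 (K * (a + b))).
Proof.
move=> XK; rewrite (card_fset_count _ m (K * (a + b))); last first.
  by move=> x xX; rewrite X_ge // XK.
apply: sub_count => i iX; apply/in_DP => //; exists (m + i) => //.
by split=> //; [apply: c_gen; lia|rewrite subnn; constructor].
Qed.

End Configurations.

(** * Amenable sets *)

Section Amenable.

Context {a b c m r : nat} {M : {fset nat}}.
Hypothesis a_gt0 : 0 < a.
Hypothesis c_gen : forall x, c <= x -> gen_semigroup a b x.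
Hypothesis M_am : amenable (gen_semigroup a b) c m r M.

Let le_cm : c <= m. Proof. by case: M_am; lia. Qed.

Let gen_ge x : m <= x -> gen_semigroup a b x.
Proof. by move=> mx; apply: c_gen; lia. Qed.

(** Peel generators of x - y off x until the ground is reached; closure keeps each stage in M. Thus
    the shadow alone decides which y < m lie in D(M). *)
Lemma amenable_descend x y : x \in M -> y < m -> y <= x ->
  gen_semigroup a b (x - y) ->
  exists z, [/\ in_shadow a b m M z & gen_semigroup a b (z - y)].
Proof.
case: M_am => _ _ _ [_ M_ge] M_cl.
elim/ltn_ind: x => x IH xM ym yx Sxy.
have mx := M_ge _ xM.
have [lt|ge] := ltnP x (m + a + b).
  by exists x; split=> //; split=> //; lia.
case E: _ / Sxy => [|u g Su ag]; first lia.
have Dg : Dx (gen_semigroup a b) x (x - g).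
  split; [apply: gen_ge; lia|lia|].
  have -> : x - (x - g) = 0 + g by lia.
  by do 2?constructor.
apply: (IH (x - g)); rewrite ?ltn_subrL; try lia.
  by apply: M_cl xM Dg _; lia.
by have -> : x - g - y = u by lia.
Qed.

Lemma amenable_in_D y : m <= y -> in_D a b M y = (y \in M).
Proof.
case: M_am => _ _ _ [_ M_ge] M_cl my.
apply/(in_DP _ _ _ _ a_gt0)/idP => [[x xM Dy]|yM]; first exact: M_cl xM Dy my.
by exists y => //; split=> //; [exact: gen_ge|rewrite subnn; constructor].
Qed.

(** An element of D(s) other than s lies in D(s - g) for some generator g, where closure of M takes
    over. *)
Lemma amenable_add s : gen_semigroup a b s -> m <= s -> s \notin M ->
  (forall g, a <= g <= a + b -> m <= s - g /\ s - g \in M) ->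
  amenable (gen_semigroup a b) c m r.+1 (s |` M)%fset.
Proof.
case: M_am => M_S M_r m_c [mM M_ge] M_cl Ss ms sM s_pred; split=> //.
- by move=> x /fset1UP[->//|/M_S].
- by rewrite cardfsU1 sM M_r.
- by split=> [|x /fset1UP[->//|/M_ge//]]; apply/fset1UP; right.
move=> x y /fset1UP[->|xM] [Sy yx Sxy] my; apply/fset1UP; last first.
  by right; apply: M_cl xM _ my.
case E: _ / Sxy => [|u g Su ag]; first by left; lia.
right; have [m_sg sgM] := s_pred _ ag.
apply: M_cl sgM _ my; split=> //; first lia.
by have -> : s - g - y = u by lia.
Qed.

(** If z > (k+1)b + t, the distances from m, ..., m + t down to the element indexed by z all lie
    strictly between kn and (k+1)a, a gap of the semigroup. *)
Lemma count_bad_ge t K : m <= K * (a + b) ->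
  (forall x, in_shadow a b m M x <-> m <= x <= m + t) ->
  \sum_(k < K) (a - (k * b + t.+1)) <=
    count (fun y => in_gen a b y && ~~ in_D a b M y) (iota 0 m).
Proof.
move=> mK shM; rewrite (count_reflect _ _ _ mK) count_rev_windows.
apply: leq_sum => k _.
have -> : a - (k * b + t.+1) = a + b - (k.+1 * b + t).+1 by lia.
rewrite -card_ord_gtn; apply/subset_leq_card/subsetP => z; rewrite !inE => zlt.
have zn := ltn_ord z.
have notS u : k * (a + b) < u < k.+1 * a -> ~ gen_semigroup a b u.
  rewrite gen_semigroup_interval => uk [l ul].
  have [lk|kl] := leqP l k; first by nia.
  by nia.
(* This gap is at most c - 1, so m >= 2c - 1 puts the element at c or above, inside the
   semigroup. *)
have be_c : k.+1 * (a + b) - z < c.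
  by rewrite ltnNge; apply/negP=> /c_gen; apply: notS; lia.
have [_ _ m_c [_ M_ge] _] := M_am.
apply/and3P; split; [lia|apply/in_genP => //; apply: c_gen; lia|].
apply/(in_DP _ _ _ _ a_gt0) => -[x xM [_ le_x Sx]].
have [|w [/shM wt]] := amenable_descend _ _ xM _ le_x Sx; first lia.
by apply: notS; lia.
Qed.

End Amenable.

(** * Ordered amenable sets *)

Lemma ordered_amenable_mem {a b c m r : nat} {M : {fset nat}} (P t k j : nat) :
  0 < b -> b < a ->
  (forall x, c <= x -> gen_semigroup a b x) ->
  amenable (gen_semigroup a b) c m r M -> is_pivot a b m M P -> t < a + b - 1 ->
  (forall x, in_shadow a b m M x <-> m <= x <= m + t) ->
  (forall s, gen_semigroup a b s -> s \notin M ->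
     amenable (gen_semigroup a b) c m r.+1 (s |` M)%fset ->
     (forall x, in_shadow a b m (s |` M)%fset x <-> in_shadow a b m M x) ->
     s = P + a) ->
  j + k * b < t -> m + (k * (a + b) + j) \in M.
Proof.
move=> b0 ba c_gen M_am M_piv t_lt shM M_ord.
elim: k j => [|k IH] j jt.
  by rewrite mul0n add0n; have [|] := (shM (m + j)).2; first lia.
(* Each s - g is m + kn + j' with j' <= j + b, so it is in M by induction. Hence s is addable and
   lies beyond the ground, which forces s = P + a. *)
set s := m + _; apply/negPn/negP => sM.
have [_ _ m_c _ _] := M_am.
have sP : s = P + a.
  apply: M_ord => //; first by apply: c_gen; rewrite /s; lia.
    apply: amenable_add => //; [lia|apply: c_gen; rewrite /s; lia|rewrite /s; lia|].
    move=> g ag; have -> : s - g = m + (k * (a + b) + (j + (a + b - g))).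
      by rewrite /s; lia.
    by split; [lia|apply: IH; lia].
  move=> x; split=> -[xM xm]; split=> //; last by apply/fset1UP; right.
  by case/fset1UP: xM => // xs; move: xm; rewrite xs /s; lia.
case: M_piv => _ [[Pm _]|[[_ [j0 [[[j0_lt _] j0_max] [q Pq]]]] _]].
  by move: sP; rewrite /s; lia.
(* The ground element m + t puts t - b in J. *)
have tJ : t - b <= j0.
  apply: j0_max; split; first lia.
  exists (m + t), 0; split; last lia.
  by have [] : in_shadow a b m M (m + t) by apply/shM; lia.
(* Both sides are below a and congruent mod a by s = P + a; yet kb + j < t - b <= [j0]. *)
suff : j0 = k * b + j by lia.
have E : ((q + 1 - k.+1%:Z) * a%:Z = (k * b + j)%:Z - j0%:Z)%R.
  by move: sP; rewrite /s; lia.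
have kbj : k * b + j < a by lia.
have : (q + 1 - k.+1%:Z = 0)%R.
  by move: E; move: (k * b + j) kbj (q + 1 - _)%R; nia.
by lia.
Qed.

(** Strictness comes from window 0, which holds t + 1 elements instead of t. *)
Lemma ordered_amenable_card {a b c m r : nat} {M : {fset nat}} (P t K : nat) :
  0 < b -> b < a ->
  (forall x, c <= x -> gen_semigroup a b x) ->
  amenable (gen_semigroup a b) c m r M -> is_pivot a b m M P -> t < a + b - 1 ->
  (forall x, in_shadow a b m M x <-> m <= x <= m + t) ->
  (forall s, gen_semigroup a b s -> s \notin M ->
     amenable (gen_semigroup a b) c m r.+1 (s |` M)%fset ->
     (forall x, in_shadow a b m (s |` M)%fset x <-> in_shadow a b m M x) ->
     s = P + a) ->
  (forall x, x \in M -> x < m + K * (a + b)) ->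
  \sum_(k < K) (t - k * b) < r.
Proof.
move=> b0 ba c_gen M_am M_piv t_lt shM M_ord M_lt.
have memM k j := ordered_amenable_mem P t k j b0 ba c_gen M_am M_piv t_lt shM M_ord.
have [_ <- _ [mM M_ge] _] := M_am.
rewrite (card_fset_count _ m (K * (a + b))); last first.
  by move=> x xM; rewrite M_ge // M_lt.
rewrite count_windows; case: K M_lt => [/(_ _ mM)|K _]; first by rewrite addn0 ltnn.
rewrite !big_ord_recl /= -addSn; apply: leq_add.
  rewrite subn0 -{1}(@card_ord_ltn (a + b) t.+1); last lia.
  apply/subset_leq_card/subsetP => i; rewrite !inE mul0n => it.
  by have [|] := (shM (m + i)).2; first lia.
apply: leq_sum => k _; rewrite -{1}(@card_ord_ltn (a + b) (t - _)); last lia.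
apply/subset_leq_card/subsetP => i; rewrite !inE => it.
by apply: memM; lia.
Qed.

Theorem theorem4p28 (a b c m r : nat) (M : {fset nat}) :
  0 < b -> b < a ->
  is_conductor (gen_semigroup a b) c ->
  2 * c - 1 <= m ->
  ordered_amenable (gen_semigroup a b) a b c m r M ->
  optimal_config (gen_semigroup a b) r m M.
Proof.
move=> b0 ba [c_gen _] m_c [M_am [P [M_piv [t [t_lt shM]] M_ord]]].
have a0 : 0 < a by lia.
have le_cm : c <= m by lia.
have [M_S M_r _ [mM M_ge] _] := M_am.
have bnd (X : {fset nat}) :
    exists K0, forall K, K0 <= K -> forall x, x \in X -> x < m + K * (a + b).
  exists (\max_(x <- X) x).+1 => K le_K x xX.
  have le_x := @leq_bigmax_seq _ (enum_fset X) xpredT id x xX isT.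
  by apply: leq_ltn_trans le_x (leq_trans le_K _); nia.
have card_D X K d : (forall x, x \in X -> x < m + K * (a + b)) ->
    card_is (DM (gen_semigroup a b) X) d <->
    d = count (in_D a b X) (iota 0 (m + K * (a + b))).
  move=> XK; apply: card_is_count => [y|y [x xX [_ yx _]]]; first exact: in_DP.
  exact: leq_ltn_trans yx (XK x xX).
have M_conf : configuration (gen_semigroup a b) m M.
  by move=> x xM; split; [exact: M_S|exact: M_ge].
have [KM M_lt] := bnd M.
split=> //; exists (count (in_D a b M) (iota 0 (m + KM * (a + b)))).
have dM := (card_D M KM _ (M_lt KM (leqnn _))).2 erefl.
split=> //; split; first by exists M.
move=> X d' X_conf X_r dX.
have [KX X_lt] := bnd X.
(* Enough windows to cover M and X above m, and everything below m. *)
pose K := KM + KX + m.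
have {}M_lt := M_lt K (leq_trans (leq_addr KX KM) (leq_addr m _)).
have {}X_lt := X_lt K (leq_trans (leq_addl KM KX) (leq_addr m _)).
have mK : m <= K * (a + b) by rewrite /K; nia.
have /(card_D _ _ _ M_lt) -> := dM.
have /(card_D _ _ _ X_lt) -> := dX.
have X_ge x : x \in X -> m <= x by case/X_conf.
have X0 : X != fset0.
  by rewrite -cardfs_gt0 X_r -M_r cardfs_gt0; apply/fset0Pn; exists m.
have eM := count_D_split a b M m (K * (a + b)).
have eX := count_D_split a b X m (K * (a + b)).
have geM := count_bad_ge a0 c_gen M_am t K mK shM.
have leX := count_bad_le a0 c_gen le_cm X_ge K X0 mK.
have cardX := card_configuration_le a0 c_gen le_cm X_ge K X_lt.
have cardM : count (fun i => in_D a b M (m + i)) (iota 0 (K * (a + b))) = r.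
  rewrite -M_r (card_fset_count _ m (K * (a + b))); last first.
    by move=> x xM; rewrite M_ge // M_lt.
  by apply: eq_count => i; rewrite (amenable_in_D a0 c_gen M_am) ?leq_addr.
have r_gt := ordered_amenable_card P t K b0 ba c_gen M_am M_piv t_lt shM M_ord M_lt.
pose T := #|[set i : 'I_(a + b) | in_D a b X (m + i)]|.
(* If T <= t, the part of D(X) from m on has fewer than r elements, yet it contains X. *)
have [Tt|tT] := leqP T t.
  have := @count_closed_windows a b (fun i => in_D a b X (m + i)) K.
  have T_lt : T < a + b by lia.
  rewrite -/T => /(_ (in_D_down a0 c_gen le_cm) T_lt).
  have : \sum_(k < K) (T - k * b) <= \sum_(k < K) (t - k * b).
    by apply: leq_sum => k _; apply: leq_sub2r.
  by lia.
(* Here X has no more bad elements than M, and D(X) has at least r elements from m on, where D(M)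
   has exactly r. *)
have : \sum_(k < K) (a - (k * b + T)) <= \sum_(k < K) (a - (k * b + t.+1)).
  by apply: leq_sum => k _; apply: leq_sub2l; rewrite leq_add2l.
rewrite -/T in leX; lia.
Qed.
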